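(* Suppose Assumption A holds. Then for every $\epsilon>0$ and $r>0$ with $\overline{\mathrm{conv}(S)}\cap\mathbf{B}_r\neq\emptyset$, there exists an integer $k_{r,\epsilon}$ such that $$\overline{\mathrm{conv}(S)}\cap\mathbf{B}_r\subseteq\widetilde{\mathrm{TH}}_{k_{r,\epsilon}}(\tilde G)\cap\mathbf{B}_r\subseteq\big(\overline{\mathrm{conv}(S)}+\epsilon\mathbf{B}_1\big)\cap\mathbf{B}_r.$$
   Context: $\mathbf{B}_r=\{x\in\mathbb{R}^n:\|x\|_2\le r\}$. $X=(X_1,\dots,X_n)$, $\tilde X=(X_0,X_1,\dots,X_n)$, $\|\cdot\|_2$ Euclidean norm. For $f\in\mathbb{R}[X]$ of degree $d$, its homogenization is $\tilde f(\tilde X)=X_0^df(X/X_0)\in\mathbb{R}[\tilde X]$. Fix $g_1,\dots,g_m\in\mathbb{R}[X]$ and $S=\{x\in\mathbb{R}^n:g_1(x)\ge0,\dots,g_m(x)\ge0\}$. Define $\tilde S^{o}=\{\tilde x=(x_0,x)\in\mathbb{R}^{n+1}:\tilde g_j(\tilde x)\ge0\ (j=1,\dots,m),\ x_0>0\}$, $\tilde S^{c}$ the same set with $x_0\ge0$ in place of $x_0>0$, and $\tilde S=\tilde S^c\cap\{\|\tilde x\|_2=1\}$. $S$ is closed at $\infty$ if $\overline{\tilde S^{o}}=\tilde S^{c}$. For a finite set $H=\{h_1,\dots,h_r\}$ of polynomials, the $k$-th quadratic module is $\mathcal{Q}_k(H)=\{\sum_{j=0}^r\sigma_jh_j:h_0=1,\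 \sigma_j\text{ sums of squares of polynomials},\ \deg(\sigma_jh_j)\le2k\}$. Let $\tilde G=\{\tilde g_1,\dots,\tilde g_m,X_0,\|\tilde X\|_2^2-1,1-\|\tilde X\|_2^2\}$. Let $\mathcal{P}[\tilde X]_1$ be the set of linear forms (homogeneous of degree one) in $\tilde X$ together with $0$. The modified theta body is $\widetilde{\mathrm{TH}}_k(\tilde G)=\{x\in\mathbb{R}^n:\tilde l(1,x)\ge0\ \forall\tilde l\in\mathcal{Q}_k(\tilde G)\cap\mathcal{P}[\tilde X]_1\}$. A closed convex cone $K$ is pointed if $K\cap(-K)=\{0\}$. Assumption A: (i) $S$ is closed at $\infty$; (ii) the convex cone $\mathrm{conv}(\overline{\tilde S^{o}})$ is closed and pointed. *)

(* Defs.v *)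
From HB Require Import structures.
From mathcomp Require Import all_boot all_order all_algebra.
From mathcomp Require Import reals.
From mathcomp Require Import mpoly.

Set Implicit Arguments.
Unset Strict Implicit.
Unset Printing Implicit Defensive.

Import Order.TTheory GRing.Theory Num.Theory.
Local Open Scope ring_scope.

Section Defs.
Variable R : realType.

Definition rvec (N : nat) := 'I_N -> R.

Definition vnorm N (x : rvec N) : R := Num.sqrt (\sum_(i < N) x i ^+ 2).

Definition eball N (r : R) : rvec N -> Prop := fun x => vnorm x <= r.

Definition eclosure N (A : rvec N -> Prop) : rvec N -> Prop :=
  fun y => forall e : R, 0 < e ->
    exists a, A a /\ vnorm (fun i => y i - a i) < e.

Definition is_closed N (A : rvec N -> Prop) : Prop :=
  forall y, eclosure A y -> A y.

Definition cvx_hull N (A : rvec N -> Prop) : rvec N -> Prop :=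
  fun y => exists (k : nat) (lam : 'I_k -> R) (pts : 'I_k -> rvec N),
    (forall i, 0 <= lam i) /\ \sum_(i < k) lam i = 1 /\
    (forall i, A (pts i)) /\
    (forall j, y j = \sum_(i < k) lam i * pts i j).

Definition pointed N (K : rvec N -> Prop) : Prop :=
  forall y, K y -> K (fun i => - y i) -> y = (fun _ => 0).

Definition set_eq N (A B : rvec N -> Prop) : Prop := forall y, A y <-> B y.
Definition set_sub N (A B : rvec N -> Prop) : Prop := forall y, A y -> B y.

Definition add_eps_ball N (A : rvec N -> Prop) (eps : R) : rvec N -> Prop :=
  fun y => exists a b, A a /\ eball 1 b /\ (forall i, y i = a i + eps * b i).

Definition ext1 n (x : rvec n) : rvec n.+1 :=
  fun i => match unlift ord0 i with None => 1 | Some j => x j end.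

(* total degree; the zero polynomial gets degree 0 *)
Definition mdegree n (f : {mpoly R[n]}) : nat := (msize f).-1.

(* homogenization  X_0^d f(X/X_0), d = deg f; variable 0 of R[n.+1] is X_0,
   variable (lift ord0 i) is X_{i+1} *)
Definition homogenize n (f : {mpoly R[n]}) : {mpoly R[n.+1]} :=
  \sum_(m <- msupp f)
     f@_m *: ('X_ord0 ^+ (mdegree f - mdeg m)
              * \prod_(i < n) 'X_(lift ord0 i) ^+ m i).

Definition is_sos N (s : {mpoly R[N]}) : Prop :=
  exists qs : seq {mpoly R[N]}, s = \sum_(q <- qs) q ^+ 2.

(* deg p <= d  (vacuous for p = 0) *)
Definition deg_le N (p : {mpoly R[N]}) (d : nat) : Prop := (msize p <= d.+1)%N.

Definition Qmod N (k : nat) (H : seq {mpoly R[N]}) : {mpoly R[N]} -> Prop :=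
  fun p => exists (s0 : {mpoly R[N]}) (s : 'I_(size H) -> {mpoly R[N]}),
    is_sos s0 /\ deg_le s0 (2 * k) /\
    (forall j, is_sos (s j) /\ deg_le (s j * H`_j) (2 * k)) /\
    p = s0 + \sum_(j < size H) s j * H`_j.

Definition linform N (p : {mpoly R[N]}) : Prop := p \is 1.-homog.

Definition Sset n m (g : 'I_m -> {mpoly R[n]}) : rvec n -> Prop :=
  fun x => forall j, 0 <= (g j).@[x].

Definition Stilde_o n m (g : 'I_m -> {mpoly R[n]}) : rvec n.+1 -> Prop :=
  fun y => (forall j, 0 <= (homogenize (g j)).@[y]) /\ 0 < y ord0.

Definition Stilde_c n m (g : 'I_m -> {mpoly R[n]}) : rvec n.+1 -> Prop :=
  fun y => (forall j, 0 <= (homogenize (g j)).@[y]) /\ 0 <= y ord0.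

Definition closed_at_infinity n m (g : 'I_m -> {mpoly R[n]}) : Prop :=
  set_eq (eclosure (Stilde_o g)) (Stilde_c g).

Definition AssumptionA n m (g : 'I_m -> {mpoly R[n]}) : Prop :=
  closed_at_infinity g /\
  is_closed (cvx_hull (eclosure (Stilde_o g))) /\
  pointed (cvx_hull (eclosure (Stilde_o g))).

Definition normsq_poly N : {mpoly R[N]} := \sum_(i < N) 'X_i ^+ 2.

Definition Gtilde n m (g : 'I_m -> {mpoly R[n]}) : seq {mpoly R[n.+1]} :=
  [seq homogenize (g j) | j <- enum 'I_m] ++
  [:: 'X_ord0; normsq_poly n.+1 - 1; 1 - normsq_poly n.+1].

Definition THtilde n m (g : 'I_m -> {mpoly R[n]}) (k : nat) : rvec n -> Prop :=
  fun x => forall l : {mpoly R[n.+1]},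
    Qmod k (Gtilde g) l -> linform l -> 0 <= l.@[ext1 x].

End Defs.

(* Main.v *)
(** If x is not in cl(conv S), separating x from cl(conv S) gives a form l0 which
    is nonnegative on the homogenized cone and negative at (1, x). A closed pointed
    convex cone K carries a form l1 that is positive on K \ {0}: each unit vector y
    of K has -y outside K, hence a functional nonnegative on K and positive at y, and
    by compactness one functional serves all the y at once. So l0 + d l1, with d > 0
    small, is positive on the spherical section of the homogenized set and negative
    near (1, x); by Putinar's theorem it lies in some truncated quadratic module, and
    compactness of the ball yields a single order k.

    Putinar's theorem is elementary here because the sphere is among the
    constraints. Subtracting multiples c (1 - s h)^(2k) h of the constraints makes the
    polynomial positive on the whole cube [-1, 1]^N; by Bernstein's expansion it is then
    a nonnegative combination of products of the 1 + X_i and 1 - X_i, and modulo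
    |X|^2 - 1 each of these factors, hence each product, is a sum of squares. *)

Require Import Defs.
From HB Require Import structures.
From mathcomp Require Import all_boot all_order all_algebra.
From mathcomp Require Import mpoly.
From mathcomp Require Import boolp classical_sets functions reals interval_inference.
From mathcomp Require Import topology convex normedtype derive realfun.
From mathcomp Require Import zify ring lra.
Import Order.TTheory GRing.Theory Num.Theory.
Import numFieldNormedType.Exports ArrowAsProduct.
Local Open Scope classical_set_scope.
Local Open Scope ring_scope.

Set Implicit Arguments.
Unset Strict Implicit.

Section EuclideanSpace.
Context {R : realType}.

Definition dotp N (u v : rvec R N) : R := \sum_(i < N) u i * v i.

Fact dotp_is_scalar N (v : rvec R N) : scalar (dotp v).
Proof.
move=> a x y; rewrite /dotp mulr_sumr -big_split; apply: eq_bigr => i _.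
by rewrite mulrDr mulrCA.
Qed.

HB.instance Definition _ N (v : rvec R N) :=
  GRing.isLinear.Build R (rvec R N) R *%R (dotp v) (dotp_is_scalar v).

Lemma dotpC N (u v : rvec R N) : dotp u v = dotp v u.
Proof. by apply: eq_bigr => i _; rewrite mulrC. Qed.

Lemma dotpDl N (u v w : rvec R N) : dotp (u + v) w = dotp u w + dotp v w.
Proof. by rewrite dotpC linearD /= !(dotpC w). Qed.

Lemma dotpZl N a (u w : rvec R N) : dotp (a *: u) w = a * dotp u w.
Proof. by rewrite dotpC linearZ /= (dotpC w). Qed.

Lemma dotp_sqrD N (u v : rvec R N) :
  dotp (u + v) (u + v) = dotp u u + 2 * dotp u v + dotp v v.
Proof. by rewrite dotpDl !linearD /= (dotpC v u); ring. Qed.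

Lemma sqr_le_dotp N (u : rvec R N) i : u i ^+ 2 <= dotp u u.
Proof.
rewrite /dotp (bigD1 i)//= -expr2 lerDl sumr_ge0// => j _.
by rewrite -expr2 sqr_ge0.
Qed.

Lemma dotp_ge0 N (u : rvec R N) : 0 <= dotp u u.
Proof. by apply: sumr_ge0 => j _; rewrite -expr2 sqr_ge0. Qed.

Lemma dotp_gt0 N (u : rvec R N) : u <> 0 -> 0 < dotp u u.
Proof.
move=> u0; rewrite lt_neqAle dotp_ge0 andbT; apply/eqP => uu; apply: u0.
apply/funext => i; apply/eqP; rewrite -sqrf_eq0 eq_le sqr_ge0 andbT.
by rewrite uu sqr_le_dotp.
Qed.

Lemma vnormE N (u : rvec R N) : vnorm u = Num.sqrt (dotp u u).
Proof. by congr Num.sqrt; apply: eq_bigr => i _; rewrite expr2. Qed.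

Lemma vnorm0 N : vnorm (0 : rvec R N) = 0.
Proof. by rewrite vnormE linear0 sqrtr0. Qed.

Lemma vnorm_gt0 N (u : rvec R N) : u <> 0 -> 0 < vnorm u.
Proof. by rewrite vnormE sqrtr_gt0; exact: dotp_gt0. Qed.

Lemma vnorm1_neq0 N (u : rvec R N) : vnorm u = 1 -> u <> 0.
Proof. by move=> u1 u0; move: u1; rewrite u0 vnorm0 => /esym/eqP; rewrite oner_eq0. Qed.

Lemma vnorm_distC N (u v : rvec R N) : vnorm (u - v) = vnorm (v - u).
Proof. by congr Num.sqrt; apply: eq_bigr => i _; rewrite -sqrrN opprB. Qed.

Lemma vnormZ N a (u : rvec R N) : vnorm (a *: u) = `|a| * vnorm u.
Proof.
by rewrite !vnormE dotpZl linearZ /= mulrA -expr2 sqrtrM ?sqr_ge0// sqrtr_sqr.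
Qed.

Lemma norm_le_vnorm N (u : rvec R N) i : `|u i| <= vnorm u.
Proof. by rewrite vnormE -sqrtr_sqr ler_wsqrtr// sqr_le_dotp. Qed.

Lemma sqr_dotp_le N (u v : rvec R N) : dotp u v ^+ 2 <= dotp u u * dotp v v.
Proof.
have [->|v0] := pselect (v = 0); first by rewrite !linear0 expr0n mulr0.
have := dotp_ge0 (dotp v v *: u - dotp u v *: v).
rewrite -scaleNr dotp_sqrD !dotpZl !linearZ /=.
rewrite (_ : _ + _ = dotp v v * (dotp u u * dotp v v - dotp u v ^+ 2)); last by ring.
by rewrite pmulr_rge0 ?dotp_gt0// subr_ge0.
Qed.

Lemma ler_vnormD N (u v : rvec R N) : vnorm (u + v) <= vnorm u + vnorm v.
Proof.
have uv : dotp u v <= vnorm u * vnorm v.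
  rewrite !vnormE -sqrtrM ?dotp_ge0// (le_trans (ler_norm _))//.
  by rewrite -sqrtr_sqr ler_wsqrtr// sqr_dotp_le.
rewrite -(@ler_pXn2r _ 2) ?nnegrE ?addr_ge0 ?sqrtr_ge0// sqrrD.
rewrite !vnormE !sqr_sqrtr ?dotp_ge0// -!vnormE dotp_sqrD.
by lra.
Qed.

Lemma continuous_dotp (T : topologicalType) N (f g : T -> rvec R N) :
  (forall i, continuous (f^~ i)) -> (forall i, continuous (g^~ i)) ->
  continuous (fun x => dotp (f x) (g x)).
Proof.
move=> cf cg x; apply: cvg_big => [|i _]; first exact: add_continuous.
by apply: cvgM; [exact: cf|exact: cg].
Qed.

Lemma continuous_meval (T : topologicalType) N (p : {mpoly R[N]}) (f : T -> rvec R N) :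
  (forall i, continuous (f^~ i)) -> continuous (fun x => p.@[f x]).
Proof.
move=> cf; have -> : (fun x => p.@[f x]) =
    fun x => \sum_(m <- msupp p) p@_m * \prod_(i < N) f x i ^+ m i.
  by apply/funext => x; rewrite mevalE.
move=> x; apply: cvg_big => [|m _]; first exact: add_continuous.
apply: cvgM; first exact: cvg_cst.
apply: cvg_big => [|i _]; first exact: mul_continuous.
exact: (continuous_comp (cf i x) (@exprn_continuous _ (m i) _)).
Qed.

Lemma rvec_coord_continuous N (i : 'I_N) : continuous (fun x : rvec R N => x i).
Proof. exact: (@proj_continuous 'I_N (fun=> R) i). Qed.

Lemma meval_continuous N (p : {mpoly R[N]}) : continuous (fun x : rvec R N => p.@[x]).
Proof. by apply: (continuous_meval (f := id)) => i; exact: rvec_coord_continuous. Qed.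

Lemma dotp_continuous N (v : rvec R N) : continuous (dotp v).
Proof.
by apply: (@continuous_dotp (rvec R N) N (cst v) id) => i;
  [exact: cst_continuous|exact: rvec_coord_continuous].
Qed.

Lemma vnorm_dist_continuous N (z : rvec R N) : continuous (fun y : rvec R N => vnorm (y - z)).
Proof.
have cB i : continuous (fun y : rvec R N => (y - z) i).
  move=> y; exact: (cvgB (@rvec_coord_continuous N i y) (@cst_continuous _ _ (z i) y)).
have -> : (fun y => vnorm (y - z)) = Num.sqrt \o (fun y => dotp (y - z) (y - z)).
  by apply/funext => y; rewrite vnormE.
move=> y; apply: continuous_comp; [exact: (continuous_dotp cB cB)|exact: sqrt_continuous].
Qed.

Lemma vnorm_continuous N : continuous (@vnorm R N).
Proof.
have -> : @vnorm R N = fun y => vnorm (y - 0) by apply/funext => y; rewrite subr0.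
exact: vnorm_dist_continuous.
Qed.

Lemma near_vnorm_lt N (x : rvec R N) e : 0 < e -> \forall y \near x, vnorm (x - y) < e.
Proof.
move=> e0; near=> y; rewrite vnorm_distC; near: y.
apply: (@vnorm_dist_continuous N x x [set t | t < e]).
by apply: open_nbhs_nbhs; split; [exact: open_lt|rewrite /= subrr vnorm0].
Unshelve. all: by end_near. Qed.

Lemma near_add_eps_ball N (A : set (rvec R N)) eps x : 0 < eps -> A x ->
  \forall y \near x, add_eps_ball A eps y.
Proof.
move=> eps0 Ax; apply: filterS (near_vnorm_lt x eps0) => y xy.
exists x, (eps^-1 *: (y - x)); split=> //; split.
  rewrite /eball vnormZ gtr0_norm ?invr_gt0// mulrC ler_pdivrMr// mul1r.
  by rewrite vnorm_distC ltW.
by move=> i; rewrite -[(_ *: _) i]/(eps^-1 * (y i - x i)) mulVKf ?gt_eqF// subrKC.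
Qed.

Lemma vnorm_cvg N (F : set_system (rvec R N)) {FF : Filter F} (x : rvec R N) :
  (forall e, 0 < e -> F [set y | vnorm (x - y) < e]) -> F --> x.
Proof.
move=> Fx; apply/cvg_sup => i; apply/cvg_image.
  by apply/seteqP; split=> // t _; exists (cst t).
move=> B /nbhs_ballP[e /= e0 eB]; exists ((fun y : rvec R N => y i) @^-1` B).
  apply: filterS (Fx _ e0) => y xy; apply: eB.
  by apply: le_lt_trans xy; exact: (norm_le_vnorm (x - y)).
by rewrite image_preimage//; apply/seteqP; split=> // t _; exists (cst t).
Qed.

Lemma eclosureE N (A : set (rvec R N)) : eclosure A = closure A.
Proof.
apply/seteqP; split=> x.
  move=> Ax; rewrite closureEcvg.
  pose B e := A `&` [set y | vnorm (x - y) < e].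
  have FB : ProperFilter (filter_from [set e : R | 0 < e] B).
    apply: filter_from_proper => [|e e0]; last first.
      by have [a Aa] := Ax e e0; exists a.
    apply: filter_from_filter; first by exists 1; exact: ltr01.
    move=> e f e0 f0; exists (Num.min e f); first by rewrite /= lt_min e0.
    by move=> y [Ay]; rewrite /B /= lt_min => /andP[].
  exists (filter_from [set e | 0 < e] B) => //; split.
    by apply: vnorm_cvg => e e0; exists e => // y [].
  by move=> C AC; exists 1; [exact: ltr01|move=> y [/AC]].
by move=> Ax e /(near_vnorm_lt x) /Ax [a [? ?]]; exists a.
Qed.

Lemma closure_vnormP N (A : set (rvec R N)) x :
  closure A x <-> forall e, 0 < e -> exists2 a, A a & vnorm (x - a) < e.
Proof.
rewrite -eclosureE; split=> Ax e e0; last by have [a] := Ax e e0; exists a.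
by have [a []] := Ax e e0; exists a.
Qed.

Lemma is_closedE N (A : set (rvec R N)) : is_closed A = closed A.
Proof. by apply/propext; rewrite /is_closed eclosureE. Qed.

Lemma compact_box N (a b : rvec R N) :
  compact [set x : rvec R N | forall i, a i <= x i <= b i].
Proof.
apply: (@tychonoff _ _ (fun i => [set t | a i <= t <= b i])) => i.
by have := @segment_compact R (a i) (b i); rewrite set_itvE.
Qed.

Lemma compact_vnorm_dist_le N (z : rvec R N) r : compact [set y | vnorm (y - z) <= r].
Proof.
apply: (@subclosed_compact _ _ [set y | forall i, (z - cst r) i <= y i <= (z + cst r) i]).
- exact: ((continuous_closedP _).1 (@vnorm_dist_continuous N z) _ (@closed_le R r)).
- exact: compact_box.
move=> y yr i; suff: z i - r <= y i <= z i + r by [].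
by rewrite -ler_distl (le_trans _ yr)//; exact: (norm_le_vnorm (y - z)).
Qed.

Lemma compact_eball N r : compact (@eball R N r).
Proof.
have := @compact_vnorm_dist_le N 0 r.
by congr compact; apply/funext => y; rewrite /eball /= subr0.
Qed.

Lemma compact_gt0_bound (T : topologicalType) (K : set T) (f : T -> R) :
  compact K -> continuous f -> (forall x, K x -> 0 < f x) ->
  exists2 d, 0 < d & forall x, K x -> d <= f x.
Proof.
move=> cK cf f0; have [->|/set0P K0] := eqVneq K set0; first by exists 1; rewrite ?ltr01.
have [x /set_mem Kx xmin] := compact_EVT_min K0 cK (continuous_subspaceT cf).
by exists (f x) => [|y Ky]; [exact: f0|exact/xmin/mem_set].
Qed.

End EuclideanSpace.

Section Convexity.
Context {R : realType}.

Lemma convex_setP N (A : set (rvec R N)) : convex_set A <->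
  forall a b t, A a -> A b -> 0 <= t <= 1 -> A (t *: a + (1 - t) *: b).
Proof.
split=> cA.
  move=> a b t Aa Ab /andP[t0 t1]; apply/set_mem.
  exact: (cA a b (Itv01 t0 t1) (mem_set Aa) (mem_set Ab)).
move=> a b t /set_mem Aa /set_mem Ab; apply/mem_set.
by apply: (cA a b t%:num) => //; rewrite ge0 le1.
Qed.

Lemma sub_cvx_hull N (A : set (rvec R N)) : A `<=` cvx_hull A.
Proof.
move=> y Ay; exists 1%N, (fun=> 1), (fun=> y); split=> //.
by split; [rewrite big_ord1 | split=> // j; rewrite big_ord1 mul1r].
Qed.

Lemma cvx_hull_convex N (A : set (rvec R N)) : convex_set (cvx_hull A).
Proof.
apply/convex_setP => a b t [k [lam [pts [lam0 [lam1 [Ap aE]]]]]].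
move=> [k' [lam' [pts' [lam'0 [lam'1 [Ap' bE]]]]]] /andP[t0 t1].
pose w (i : 'I_(k + k')) :=
  match fintype.split i with inl i => t * lam i | inr i => (1 - t) * lam' i end.
pose p (i : 'I_(k + k')) :=
  match fintype.split i with inl i => pts i | inr i => pts' i end.
have splitl i : fintype.split (lshift k' i) = inl i :> 'I_k + 'I_k'.
  exact: (unsplitK (inl i)).
have splitr i : fintype.split (rshift k i) = inr i :> 'I_k + 'I_k'.
  exact: (unsplitK (inr i)).
exists (k + k')%N, w, p; split; last split; last split.
- by move=> i; rewrite /w; case: (fintype.split i) => j; rewrite mulr_ge0// subr_ge0.
- rewrite big_split_ord /= /w; under eq_bigr do rewrite splitl.
  under [X in _ + X]eq_bigr do rewrite splitr.
  by rewrite -!mulr_sumr lam1 lam'1 !mulr1 subrKC.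
- by move=> i; rewrite /p; case: (fintype.split i).
move=> j; rewrite /w /p big_split_ord /=.
rewrite -[LHS]/(t * a j + (1 - t) * b j) aE bE !mulr_sumr.
by congr (_ + _); apply: eq_bigr => i _; rewrite ?splitl ?splitr mulrA.
Qed.

Lemma closure_convex N (A : set (rvec R N)) : convex_set A -> convex_set (closure A).
Proof.
move=> /convex_setP cA; apply/convex_setP => a b t.
move=> /closure_vnormP Aa /closure_vnormP Ab /andP[t0 t1].
apply/closure_vnormP => e e0; have e20 : 0 < e / 2 by lra.
have [a' Aa' aa'] := Aa _ e20; have [b' Ab' bb'] := Ab _ e20.
exists (t *: a' + (1 - t) *: b'); first by apply: cA; rewrite ?t0.
have -> : t *: a + (1 - t) *: b - (t *: a' + (1 - t) *: b') =
    t *: (a - a') + (1 - t) *: (b - b').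
  by rewrite opprD addrACA -!scalerBr.
apply: (le_lt_trans (ler_vnormD _ _)); rewrite !vnormZ !ger0_norm ?subr_ge0//.
by nra.
Qed.

Definition is_cone N (A : set (rvec R N)) := forall t a, 0 <= t -> A a -> A (t *: a).

Lemma cvx_hull_cone N (A : set (rvec R N)) : is_cone A -> is_cone (cvx_hull A).
Proof.
move=> cA t y t0 [k [lam [pts [lam0 [lam1 [Ap yE]]]]]].
exists k, lam, (fun i => t *: pts i); split=> //; split=> //; split.
  by move=> i; exact: cA.
move=> j; rewrite -[LHS]/(t * y j) yE mulr_sumr.
by apply: eq_bigr => i _; rewrite mulrCA.
Qed.

Lemma cvx_hull_halfspace N (A : set (rvec R N)) v c :
  A `<=` [set y | c <= dotp v y] -> cvx_hull A `<=` [set y | c <= dotp v y].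
Proof.
move=> Ac y [k [lam [pts [lam0 [lam1 [Ap yE]]]]]] /=.
have -> : y = \sum_(i < k) lam i *: pts i by apply/funext => j; rewrite yE fct_sumE.
rewrite linear_sum -[c]mul1r -lam1 mulr_suml; apply: ler_sum => i _ /=.
by rewrite linearZ ler_wpM2l//; exact: Ac.
Qed.

Lemma closure_halfspace N (A : set (rvec R N)) v c :
  A `<=` [set y | c <= dotp v y] -> closure A `<=` [set y | c <= dotp v y].
Proof.
move=> Ac; rewrite closureE; apply: smallest_sub => //.
exact: ((continuous_closedP _).1 (@dotp_continuous R N v) _ (@closed_ge R c)).
Qed.

Lemma nearest_point N (D : set (rvec R N)) z : closed D -> D !=set0 ->
  exists2 p, D p & forall y, D y -> vnorm (p - z) <= vnorm (y - z).
Proof.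
move=> cD [a Da]; pose B := [set y | vnorm (y - z) <= vnorm (a - z)] `&` D.
have cB : compact B by apply: compact_closedI => //; exact: compact_vnorm_dist_le.
have B0 : B !=set0 by exists a; split=> /=.
have [p /set_mem[pa Dp] pmin] :=
  compact_EVT_min B0 cB (continuous_subspaceT (@vnorm_dist_continuous R N z)).
exists p => // y Dy; have [ya|/ltW ay] := leP (vnorm (y - z)) (vnorm (a - z)).
  by apply: pmin; apply/mem_set.
exact: le_trans pa ay.
Qed.

Lemma nearest_point_obtuse N (D : set (rvec R N)) z p y : convex_set D -> D p ->
  (forall q, D q -> vnorm (p - z) <= vnorm (q - z)) -> D y ->
  dotp (p - z) p <= dotp (p - z) y.
Proof.
move=> /convex_setP cD Dp pmin Dy; rewrite -subr_ge0 -linearB leNgt; apply/negP => /=.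
set v := p - z; set w := y - p; set vw := dotp v w => vw_lt0.
pose ww := dotp w w; have ww_ge0 : 0 <= ww by exact: dotp_ge0.
have den_gt0 : 0 < ww - vw by lra.
pose t := - vw / (ww - vw); have t0 : 0 < t by rewrite divr_gt0//; lra.
have t01 : 0 <= t <= 1 by rewrite ltW// ler_pdivrMr//; lra.
have := pmin _ (cD _ _ _ Dy Dp t01).
have -> : t *: y + (1 - t) *: p - z = v + t *: w.
  by rewrite scalerBl scale1r scalerBr addrCA addrAC.
rewrite -/v !vnormE ler_sqrt ?dotp_ge0// dotp_sqrD dotpZl !linearZ /= -/vw -/ww.
have t_ww : t * ww = - vw - t * - vw by rewrite /t; field; lra.
by nra.
Qed.

Lemma separation N (D : set (rvec R N)) z : closed D -> convex_set D -> D !=set0 ->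
  ~ D z -> exists v c, D `<=` [set y | c <= dotp v y] /\ dotp v z < c.
Proof.
move=> clD cvD D0 nDz; have [p Dp pmin] := nearest_point z clD D0.
exists (p - z), (dotp (p - z) p); split=> [y|].
  exact: (nearest_point_obtuse cvD Dp pmin).
rewrite -subr_gt0 -linearB; apply: dotp_gt0 => pz; apply: nDz.
by move/eqP: pz; rewrite subr_eq0 => /eqP <-.
Qed.

Definition dual_cone N (A : set (rvec R N)) : set (rvec R N) :=
  [set v | forall y, A y -> 0 <= dotp v y].

Lemma cone_separation N (K : set (rvec R N)) z : closed K -> convex_set K -> is_cone K ->
  K !=set0 -> ~ K z -> exists2 v, dual_cone K v & dotp v z < 0.
Proof.
move=> clK cvK sK K0 nKz; have [v [c [Kc vz]]] := separation clK cvK K0 nKz.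
have c0 : c <= 0.
  by have [k Kk] := K0; have := Kc _ (sK 0 _ (lexx 0) Kk); rewrite scale0r /= linear0.
exists v; last exact: lt_le_trans vz c0.
move=> k Kk; rewrite leNgt; apply/negP => vk.
have t0 : 0 <= (1 - c) / - dotp v k by rewrite divr_ge0 ?oppr_ge0 ?(ltW vk)//; lra.
have := Kc _ (sK _ _ t0 Kk); rewrite /= linearZ /=.
by rewrite invrN mulrN mulNr divfK ?lt_eqF//; lra.
Qed.

(* The dual cone is directed, since v + w dominates v and w on S; along the filter of
   its upper sections, compactness turns pointwise positivity into uniform positivity. *)
Lemma compact_dual_cone_gt0 N (S : set (rvec R N)) : compact S ->
  (forall y, S y -> exists2 v, dual_cone S v & 0 < dotp v y) ->
  exists v, forall y, S y -> 0 < dotp v y.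
Proof.
move=> /compact_near_coveringP/near_covering_withinP cS Spos.
pose above v := [set u | forall y, S y -> dotp v y <= dotp u y].
have FF : ProperFilter (filter_from (dual_cone S) above).
  apply: filter_from_proper => [|v _]; last by exists v.
  apply: filter_from_filter; first by exists 0 => y _; rewrite dotpC linear0.
  move=> v w Sv Sw; exists (v + w) => [y Sy|u vwu].
    by rewrite dotpDl addr_ge0 ?Sv ?Sw.
  by split=> y Sy; apply: le_trans (vwu y Sy); rewrite dotpDl ?lerDl ?lerDr ?Sv ?Sw.
suff /filter_ex[u uS] : \forall u \near filter_from (dual_cone S) above,
    S `<=` (fun y => 0 < dotp u y) by exists u.
apply: cS => x /Spos[v Sv vx].
exists ([set y | 0 < dotp v y], above v) => [|[y u] [/= vy vu] Sy].
  split; last by exists v.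
  apply: open_nbhs_nbhs; split=> //=.
  exact: ((continuousP _).1 (@dotp_continuous R N v) _ (@open_gt R 0)).
exact: lt_le_trans vy (vu y Sy).
Qed.

Lemma pointed_cone_dual_gt0 N (K : set (rvec R N)) :
  closed K -> convex_set K -> is_cone K -> pointed K ->
  exists v, forall y, K y -> y <> 0 -> 0 < dotp v y.
Proof.
move=> clK cvK sK pK; pose S := K `&` [set y | vnorm y = 1].
have cS : compact S.
  apply: (subclosed_compact _ (@compact_eball R N 1)).
    apply: closedI => //.
    exact: ((continuous_closedP _).1 (@vnorm_continuous R N) _ (@closed_eq R 1)).
  by move=> y [_ /= y1]; rewrite /eball y1.
have [y [Ky /= y1]|v vS] := compact_dual_cone_gt0 cS.
  have nKy : ~ K (- y) by move=> /(pK _ Ky); exact: vnorm1_neq0.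
  have [v Kv vy] := cone_separation clK cvK sK (ex_intro _ y Ky) nKy.
  exists v; first by move=> k [Kk _]; exact: Kv.
  by rewrite -oppr_lt0 -linearN.
exists v => y Ky /vnorm_gt0 y0.
have : S ((vnorm y)^-1 *: y).
  split; first by apply: sK; rewrite ?invr_ge0 ?ltW.
  by rewrite /= vnormZ gtr0_norm ?invr_gt0// mulVf// gt_eqF.
by move/vS; rewrite linearZ /= pmulr_rgt0// invr_gt0.
Qed.

End Convexity.

Section Bernstein.
Context {R : realType}.

Definition bernstein_coef (D k j : nat) : R := (j ^_ k)%:R / (D ^_ k)%:R.

Lemma ffact_bin_shift k d i : (i <= d)%N ->
  ((k + i) ^_ k * 'C(k + d, k + i) = (k + d) ^_ k * 'C(d, i))%N.
Proof.
move=> id; have kid : (k + i <= k + d)%N by rewrite leq_add2l.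
have ffact_ki := ffact_fact (leq_addr i k); rewrite addKn in ffact_ki.
have ffact_kd := ffact_fact (leq_addr d k); rewrite addKn in ffact_kd.
have bin_kd := bin_fact kid; rewrite subnDl in bin_kd.
apply/eqP; rewrite -(eqn_pmul2r (fact_gt0 i)) -(eqn_pmul2r (fact_gt0 (d - i))).
apply/eqP; transitivity ((k + d)`!)%N; first by rewrite -bin_kd -ffact_ki; ring.
by rewrite -ffact_kd -(bin_fact id); ring.
Qed.

Lemma exprn_bernstein (A : comAlgType R) (t u : A) D k : (k <= D)%N -> t + u = 1 ->
  t ^+ k = \sum_(j < D.+1)
    bernstein_coef D k j *: ((t ^+ j * u ^+ (D - j)) *+ 'C(D, j)).
Proof.
move=> /subnKC <-; move: (D - k)%N => d tu.
rewrite -addnS big_split_ord /= big1 ?add0r; last first.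
  by move=> j _; rewrite /bernstein_coef ffact_small// mul0r scale0r.
rewrite -[LHS]mulr1 -[1](expr1n _ d) -tu addrC exprDn mulr_sumr.
apply: eq_bigr => i _; rewrite -mulrnAr.
have id : (i <= d)%N by rewrite -ltnS.
have nz : ((k + d) ^_ k)%:R != 0 :> R by rewrite pnatr_eq0 -lt0n ffact_gt0 leq_addr.
rewrite subnDl exprD -mulrnAr -scaler_nat -[X in _ = _ *: (_ * X)]scaler_nat -!scalerAr.
rewrite scalerA [u ^+ _ * _]mulrC mulrA; congr (_ *: _).
by rewrite /bernstein_coef mulrAC -natrM ffact_bin_shift// natrM mulrAC mulfV// mul1r.
Qed.

Lemma prod_exprn_bernstein (A : comAlgType R) N (t u : 'I_N -> A) D (m : 'I_N -> nat) :
  (forall i, m i <= D)%N -> (forall i, t i + u i = 1) ->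
  \prod_(i < N) t i ^+ m i = \sum_(f : {ffun 'I_N -> 'I_D.+1})
    (\prod_(i < N) bernstein_coef D (m i) (f i)) *:
    \prod_(i < N) ((t i ^+ f i * u i ^+ (D - f i)) *+ 'C(D, f i)).
Proof.
move=> mD tu.
rewrite (eq_bigr _ (fun i _ => exprn_bernstein (mD i) (tu i))).
by rewrite bigA_distr_bigA; apply: eq_bigr => f _; rewrite scaler_prod.
Qed.

Lemma bernstein_coef_bounds D k j : (k <= D)%N -> (j <= D)%N ->
  0 <= bernstein_coef D k j <= 1.
Proof.
move=> kD jD; apply/andP; split; first by rewrite divr_ge0.
rewrite ler_pdivrMr ?mul1r ?ltr0n ?ffact_gt0// ler_nat.
elim: k kD => // k IH kD; rewrite !ffactnSr leq_mul ?IH ?leq_sub2r//.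
exact: ltnW.
Qed.

Lemma ler_dist_prod2 (a b c d : R) : 0 <= b <= 1 -> 0 <= c <= 1 ->
  `|a * b - c * d| <= `|a - c| + `|b - d|.
Proof.
move=> /andP[b0 b1] /andP[c0 c1].
have -> : a * b - c * d = (a - c) * b + c * (b - d) by ring.
rewrite (le_trans (ler_normD _ _))// !normrM (ger0_norm b0) (ger0_norm c0).
by rewrite lerD ?ler_piMr ?ler_piMl.
Qed.

Lemma ler_dist_prod I (s : seq I) (a b : I -> R) :
  (forall i, 0 <= a i <= 1) -> (forall i, 0 <= b i <= 1) ->
  `|\prod_(i <- s) a i - \prod_(i <- s) b i| <= \sum_(i <- s) `|a i - b i|.
Proof.
move=> a01 b01; elim: s => [|i s IH]; first by rewrite !big_nil subrr normr0.
rewrite !big_cons (le_trans (ler_dist_prod2 _ _ _ _))// ?lerD2l//.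
apply/andP; split; first by apply: prodr_ge0 => j _; case/andP: (a01 j).
by apply: prodr_ile1 => j _.
Qed.

Lemma ler_dist_ratio_shift D k j : (k < D)%N -> (j <= D)%N ->
  `|(j - k)%:R / (D - k)%:R - j%:R / D%:R| <= k%:R / D%:R :> R.
Proof.
move=> kD jD; have D0 : 0 < D%:R :> R by rewrite ltr0n (leq_trans _ kD).
have Dk : 0 < (D - k)%:R :> R by rewrite ltr0n subn_gt0.
have [kj|/ltnW jk] := leqP k j; last first.
  move: (jk); rewrite -subn_eq0 => /eqP ->; rewrite mul0r sub0r normrN.
  by rewrite ger0_norm ?divr_ge0// ler_pM2r ?invr_gt0// ler_nat.
have -> : (j - k)%:R / (D - k)%:R - j%:R / D%:R =
    - (k%:R / D%:R * ((D - j)%:R / (D - k)%:R)) :> R.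
  move: Dk; rewrite !natrB// ?(ltnW kD)// => Dk.
  by field; rewrite !gt_eqF.
rewrite normrN ger0_norm; last by rewrite !mulr_ge0 ?invr_ge0.
by rewrite ler_piMr ?divr_ge0// ler_pdivrMr// mul1r ler_nat leq_sub2l.
Qed.

Lemma bernstein_coef_approx D k j : (0 < D)%N -> (k <= D)%N -> (j <= D)%N ->
  `|bernstein_coef D k j - (j%:R / D%:R) ^+ k| <= (k ^ 2)%:R / D%:R.
Proof.
move=> D0 kD jD; have D0' : 0 < D%:R :> R by rewrite ltr0n.
have /andP[jD0 jD1] : 0 <= (j%:R / D%:R : R) <= 1.
  by rewrite divr_ge0//= ler_pdivrMr// mul1r ler_nat.
elim: k kD => [|k IH] kD.
  by rewrite /bernstein_coef !ffactn0 expr0 divr1 subrr normr0 divr_ge0.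
rewrite /bernstein_coef !ffactnSr !natrM -mulf_div exprSr.
apply: (le_trans (ler_dist_prod2 _ _ _ _)).
- rewrite divr_ge0//= ler_pdivrMr ?mul1r ?ler_nat ?leq_sub2r//.
  by rewrite ltr0n subn_gt0.
- by rewrite exprn_ge0//= exprn_ile1.
apply: (le_trans (lerD (IH (ltnW kD)) (ler_dist_ratio_shift kD jD))).
by rewrite -mulrDl ler_pM2r ?invr_gt0// -natrM -natrD ler_nat -mulnn; nia.
Qed.

Definition mbernstein_coef N (p : {mpoly R[N]}) D (f : {ffun 'I_N -> 'I_D.+1}) : R :=
  \sum_(m <- msupp p) p@_m * \prod_(i < N) bernstein_coef D (m i) (f i).

Lemma msupp_leq_degree N (p : {mpoly R[N]}) D (m : 'X_{1..N}) i :
  (msize p <= D.+1)%N -> m \in msupp p -> (m i <= D)%N.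
Proof.
move=> pD mp; have := leq_trans (msize_mdeg_lt mp) pD.
by rewrite mdegE (bigD1 i)//=; lia.
Qed.

Lemma comp_mpoly_bernstein N M (p : {mpoly R[N]}) (t : N.-tuple {mpoly R[M]}) D :
  (msize p <= D.+1)%N ->
  p \mPo t = \sum_(f : {ffun 'I_N -> 'I_D.+1}) mbernstein_coef p f *:
    \prod_(i < N) ((tnth t i ^+ f i * (1 - tnth t i) ^+ (D - f i)) *+ 'C(D, f i)).
Proof.
move=> pD; have tu i : tnth t i + (1 - tnth t i) = 1 by rewrite subrKC.
under [RHS]eq_bigr do rewrite scaler_suml.
rewrite exchange_big comp_mpolyE /= !big_seq; apply: eq_bigr => m mp.
rewrite (prod_exprn_bernstein (fun i => msupp_leq_degree i pD mp) tu) scaler_sumr.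
by apply: eq_bigr => f _; rewrite scalerA.
Qed.

Lemma mbernstein_coef_approx N (p : {mpoly R[N]}) D (f : {ffun 'I_N -> 'I_D.+1}) :
  (0 < D)%N -> (msize p <= D.+1)%N ->
  `|mbernstein_coef p f - p.@[fun i => (f i)%:R / D%:R]| <=
    (\sum_(m <- msupp p) `|p@_m| * \sum_(i < N) (m i ^ 2)%:R) / D%:R.
Proof.
move=> D0 pD; have fD i : (f i <= D)%N by rewrite -ltnS.
rewrite mevalE /mbernstein_coef -sumrB (le_trans (ler_norm_sum _ _ _))// mulr_suml.
rewrite !big_seq; apply: ler_sum => m mp; have mD i := msupp_leq_degree i pD mp.
rewrite -mulrBr normrM -mulrA ler_wpM2l// mulr_suml.
apply: (le_trans (ler_dist_prod _ _ _)).
- by move=> i; exact: bernstein_coef_bounds.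
- move=> i; have f_ge0 : 0 <= (f i)%:R / D%:R :> R by rewrite divr_ge0.
  by rewrite exprn_ge0// exprn_ile1// ler_pdivrMr ?ltr0n// mul1r ler_nat.
- by apply: ler_sum => i _; exact: bernstein_coef_approx.
Qed.

Lemma mbernstein_coef_ge0 N (p : {mpoly R[N]}) :
  (forall x : rvec R N, (forall i, 0 <= x i <= 1) -> 0 < p.@[x]) ->
  \forall D \near \oo, forall f : {ffun 'I_N -> 'I_D.+1}, 0 <= mbernstein_coef p f.
Proof.
move=> p0; have [d d0 pd] :=
  compact_gt0_bound (@compact_box R N 0 (cst 1)) (@meval_continuous R N p) p0.
pose C : R := \sum_(m <- msupp p) `|p@_m| * \sum_(i < N) (m i ^ 2)%:R.
near=> D => f; have D0 : (0 < D)%N by near: D; exact: nbhs_infty_gt.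
have pD : (msize p <= D)%N by near: D; exact: nbhs_infty_ge.
have CD : C / D%:R <= d.
  by rewrite ler_pdivrMr ?ltr0n// mulrC -ler_pdivrMr//; near: D; exact: nbhs_infty_ger.
have dp : d <= p.@[fun i => (f i)%:R / D%:R].
  by apply: pd => i; rewrite /= divr_ge0//= ler_pdivrMr ?ltr0n// mul1r ler_nat -ltnS.
have := mbernstein_coef_approx f D0 (leqW pD).
by rewrite ler_norml -/C => /andP[? _]; lra.
Unshelve. all: by end_near. Qed.

Definition multiplicative_cone (A : algType R) (T : A -> Prop) : Prop :=
  [/\ T 1, (forall p q, T p -> T q -> T (p + q)),
      (forall p q, T p -> T q -> T (p * q)) &
      (forall c p, 0 <= c -> T p -> T (c *: p))].

Lemma handelman_unit_box N M (p : {mpoly R[N]}) (T : {mpoly R[M]} -> Prop)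
    (t : N.-tuple {mpoly R[M]}) :
  (forall x : rvec R N, (forall i, 0 <= x i <= 1) -> 0 < p.@[x]) ->
  multiplicative_cone T -> (forall i, T (tnth t i)) -> (forall i, T (1 - tnth t i)) ->
  T (p \mPo t).
Proof.
move=> p0 [T1 TD TM TZ] Tt Tu.
near \oo => D; have pD : (msize p <= D)%N by near: D; exact: nbhs_infty_ge.
have coef_ge0 : forall f : {ffun 'I_N -> 'I_D.+1}, 0 <= mbernstein_coef p f.
  by near: D; exact: mbernstein_coef_ge0.
have TX a k : T a -> T (a ^+ k).
  by move=> Ta; rewrite -[k]card_ord -prodr_const; apply: (big_ind T).
rewrite (comp_mpoly_bernstein _ (leqW pD)).
apply: (big_ind T) => // [|f _]; first by rewrite -(scale0r 1); exact: TZ.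
apply/TZ => //.
apply: (big_ind T) => // i _; rewrite -scaler_nat; apply/TZ => //.
by apply/TM; exact: TX.
Unshelve. all: by end_near. Qed.

Lemma comp_mpolyA N M L (p : {mpoly R[N]}) (s : N.-tuple {mpoly R[M]})
    (t : M.-tuple {mpoly R[L]}) :
  (p \mPo s) \mPo t = p \mPo [tuple tnth s i \mPo t | i < N].
Proof.
rewrite (comp_mpolyE p s) (comp_mpolyE p [tuple _ | i < N]) raddf_sum.
apply: eq_bigr => m _ /=; rewrite comp_mpolyZ rmorph_prod; congr (_ *: _).
by apply: eq_bigr => i _; rewrite rmorphXn tnth_mktuple.
Qed.

Lemma handelman_cube N (p : {mpoly R[N]}) (T : {mpoly R[N]} -> Prop) :
  (forall x : rvec R N, (forall i, -1 <= x i <= 1) -> 0 < p.@[x]) ->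
  multiplicative_cone T ->
  (forall i, T (2^-1 *: (1 + 'X_i))) -> (forall i, T (2^-1 *: (1 - 'X_i))) -> T p.
Proof.
move=> p0 Tc Tt Tu.
pose s : N.-tuple {mpoly R[N]} := [tuple 2 *: 'X_i - 1 | i < N].
pose t : N.-tuple {mpoly R[N]} := [tuple 2^-1 *: (1 + 'X_i) | i < N].
have st_id i : (2 *: 'X_i - 1) \mPo t = 'X_i.
  rewrite comp_mpolyB comp_mpolyZ comp_mpoly1 comp_mpolyXU.
  by rewrite -tnth_nth tnth_mktuple scalerA mulfV ?pnatr_eq0// scale1r addrC addKr.
have <- : (p \mPo s) \mPo t = p.
  rewrite comp_mpolyA -[RHS]comp_mpoly_id; congr (_ \mPo _).
  by apply: eq_from_tnth => i; rewrite !tnth_mktuple.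
apply: handelman_unit_box => // [x x01|i|i].
- rewrite comp_mpoly_meval; apply: p0 => i.
  rewrite tnth_mktuple mevalB mevalZ mevalXU meval1.
  by have := x01 i; lra.
- by rewrite tnth_mktuple.
rewrite tnth_mktuple (_ : _ - _ = 2^-1 *: (1 - 'X_i))//.
have half1 : 2^-1 *: 1 + 2^-1 *: 1 = 1 :> {mpoly R[N]}.
  by rewrite -scalerDl -[2^-1]mul1r -splitr scale1r.
by rewrite -{1}half1 scalerDr opprD addrA addrK -scalerBr.
Qed.

End Bernstein.

Section SumsOfSquares.
Context {R : realType}.

Lemma is_sos0 N : is_sos (0 : {mpoly R[N]}).
Proof. by exists [::]; rewrite big_nil. Qed.

Lemma is_sos_sqr N (q : {mpoly R[N]}) : is_sos (q ^+ 2).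
Proof. by exists [:: q]; rewrite big_seq1. Qed.

Lemma is_sosD N (p q : {mpoly R[N]}) : is_sos p -> is_sos q -> is_sos (p + q).
Proof. by move=> [s ->] [t ->]; exists (s ++ t); rewrite big_cat. Qed.

Lemma is_sosM N (p q : {mpoly R[N]}) : is_sos p -> is_sos q -> is_sos (p * q).
Proof.
move=> [s ->] [t ->]; rewrite big_distrlr /=.
apply: (big_ind (@is_sos R N)) => [||a _]; [exact: is_sos0|exact: is_sosD|].
apply: (big_ind (@is_sos R N)) => [||b _]; [exact: is_sos0|exact: is_sosD|].
by rewrite -exprMn; exact: is_sos_sqr.
Qed.

Lemma is_sosZ N c (p : {mpoly R[N]}) : 0 <= c -> is_sos p -> is_sos (c *: p).
Proof.
move=> c0 [s ->]; exists [seq Num.sqrt c *: b | b <- s].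
rewrite big_map scaler_sumr; apply: eq_bigr => b _.
by rewrite exprZn sqr_sqrtr.
Qed.

Lemma is_sos_ge0 N (p : {mpoly R[N]}) x : is_sos p -> 0 <= p.@[x].
Proof.
move=> [s ->]; rewrite raddf_sum; apply: sumr_ge0 => q _ /=.
by rewrite rmorphXn sqr_ge0.
Qed.

Definition sos_mod_sphere N (p : {mpoly R[N]}) : Prop :=
  exists s q, is_sos s /\ p = s + q * (1 - normsq_poly R N).

Lemma sos_mod_sphere_cone N : multiplicative_cone (@sos_mod_sphere N).
Proof.
split.
- by exists 1, 0; rewrite mul0r addr0 -(expr1n _ 2); split=> //; exact: is_sos_sqr.
- move=> _ _ [s [q [sos_s ->]]] [s' [q' [sos_s' ->]]]; exists (s + s'), (q + q').
  by split; [exact: is_sosD | rewrite mulrDl addrACA].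
- move=> _ _ [s [q [sos_s ->]]] [s' [q' [sos_s' ->]]].
  exists (s * s'), (s * q' + q * s' + q * q' * (1 - normsq_poly R N)).
  by split; [exact: is_sosM | ring].
- move=> c _ c0 [s [q [sos_s ->]]]; exists (c *: s), (c *: q).
  by split; [exact: is_sosZ | rewrite scalerDr scalerAl].
Qed.

(* (1 + e X_i)^2 + \sum_(j != i) X_j^2 = 2 (1 + e X_i) + (|X|^2 - 1) when e^2 = 1. *)
Lemma sos_mod_sphere_coord N (i : 'I_N) (e : {mpoly R[N]}) : e ^+ 2 = 1 ->
  sos_mod_sphere (2^-1 *: (1 + e * 'X_i)).
Proof.
move=> e1; pose S : {mpoly R[N]} := \sum_(j < N | j != i) 'X_j ^+ 2.
have sos_S : is_sos S.
  by apply: (big_ind (@is_sos R N)) => [||j _];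
    [exact: is_sos0|exact: is_sosD|exact: is_sos_sqr].
have normsqE : normsq_poly R N = (e * 'X_i) ^+ 2 + S.
  by rewrite /normsq_poly (bigD1 i)//= exprMn e1 mul1r.
exists (4^-1 *: ((1 + e * 'X_i) ^+ 2 + S)), (4^-1 *: 1); split.
  by apply: is_sosZ; [rewrite invr_ge0|apply: is_sosD => //; exact: is_sos_sqr].
rewrite -scalerAl mul1r -scalerDr normsqE.
have -> : (1 + e * 'X_i) ^+ 2 + S + (1 - ((e * 'X_i) ^+ 2 + S)) = 2 *: (1 + e * 'X_i).
  by rewrite scaler_nat; ring.
by rewrite scalerA; congr (_ *: _); field.
Qed.

Lemma pos_cube_sos_mod_sphere N (p : {mpoly R[N]}) :
  (forall x : rvec R N, (forall i, -1 <= x i <= 1) -> 0 < p.@[x]) -> sos_mod_sphere p.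
Proof.
move=> p0; apply: (handelman_cube p0 (@sos_mod_sphere_cone N)) => i.
  by rewrite -['X_i]mul1r; apply: sos_mod_sphere_coord; rewrite expr1n.
by rewrite -mulN1r; apply: sos_mod_sphere_coord; rewrite sqrrN expr1n.
Qed.

Definition quad_module N (H : seq {mpoly R[N]}) (p : {mpoly R[N]}) : Prop :=
  exists (s0 : {mpoly R[N]}) (s : 'I_(size H) -> {mpoly R[N]}),
    [/\ is_sos s0, (forall j, is_sos (s j)) & p = s0 + \sum_(j < size H) s j * H`_j].

Lemma quad_module_Qmod N (H : seq {mpoly R[N]}) p :
  quad_module H p -> exists k, Qmod k H p.
Proof.
move=> [s0 [s [sos_s0 sos_s ->]]].
exists (msize s0 + \sum_(j < size H) msize (s j * H`_j))%N, s0, s.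
split=> //; split; first by rewrite /deg_le; lia.
by split=> // j; split=> //; rewrite /deg_le (bigD1 j)//=; lia.
Qed.

Lemma Qmod_leq N (H : seq {mpoly R[N]}) p k l : (k <= l)%N -> Qmod k H p -> Qmod l H p.
Proof.
move=> kl [s0 [s [sos_s0 [deg_s0 [s_spec ->]]]]]; exists s0, s; split=> //; split.
  by move: deg_s0; rewrite /deg_le; lia.
split=> // j; have [sos_s deg_s] := s_spec j; split=> //.
by move: deg_s; rewrite /deg_le; lia.
Qed.

Definition nonneg_locus N (H : seq {mpoly R[N]}) : set (rvec R N) :=
  [set x | forall h, h \in H -> 0 <= h.@[x]].

Lemma Qmod_ge0 N k (H : seq {mpoly R[N]}) p x :
  Qmod k H p -> nonneg_locus H x -> 0 <= p.@[x].
Proof.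
move=> [s0 [s [sos_s0 [_ [s_spec ->]]]]] Hx; rewrite mevalD raddf_sum addr_ge0 ?is_sos_ge0//.
apply: sumr_ge0 => j _ /=; have [sos_s _] := s_spec j.
by rewrite mevalM mulr_ge0//; [exact: is_sos_ge0|exact/Hx/mem_nth].
Qed.

Lemma quad_moduleD N (H : seq {mpoly R[N]}) p q :
  quad_module H p -> quad_module H q -> quad_module H (p + q).
Proof.
move=> [s0 [s [sos_s0 sos_s ->]]] [t0 [t [sos_t0 sos_t ->]]].
exists (s0 + t0), (fun j => s j + t j); split; first exact: is_sosD.
  by move=> j; exact: is_sosD.
rewrite addrACA -big_split; congr (_ + _).
by apply: eq_bigr => j _; rewrite mulrDl.
Qed.

Lemma quad_module_sos N (H : seq {mpoly R[N]}) p : is_sos p -> quad_module H p.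
Proof.
move=> sos_p; exists p, (fun=> 0); split=> //; first by move=> _; exact: is_sos0.
by rewrite big1 ?addr0// => j _; rewrite mul0r.
Qed.

Lemma quad_moduleM N (H : seq {mpoly R[N]}) s h :
  is_sos s -> h \in H -> quad_module H (s * h).
Proof.
move=> sos_s hH; have ltH : (index h H < size H)%N by rewrite index_mem.
exists 0, (fun j => if j == Ordinal ltH then s else 0); split; first exact: is_sos0.
  by move=> j; case: ifP => // _; exact: is_sos0.
rewrite add0r (bigD1 (Ordinal ltH))//= eqxx nth_index// big1 ?addr0//.
by move=> j /negbTE ->; rewrite mul0r.
Qed.

Lemma quad_module_sphere N (H : seq {mpoly R[N]}) (q : {mpoly R[N]}) :
  normsq_poly R N - 1 \in H -> 1 - normsq_poly R N \in H ->
  quad_module H (q * (1 - normsq_poly R N)).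
Proof.
move=> sphere_ge0 sphere_le0.
have -> : q * (1 - normsq_poly R N) =
    (2^-1 *: (q + 1)) ^+ 2 * (1 - normsq_poly R N) +
    (2^-1 *: (q - 1)) ^+ 2 * (normsq_poly R N - 1).
  rewrite !exprZn -!scalerAl -scalerDr.
  have -> : (q + 1) ^+ 2 * (1 - normsq_poly R N) + (q - 1) ^+ 2 * (normsq_poly R N - 1) =
    4 *: (q * (1 - normsq_poly R N)) by rewrite scaler_nat; ring.
  by rewrite scalerA (_ : 2^-1 ^+ 2 * 4 = 1) ?scale1r//; field.
by apply: quad_moduleD; apply: quad_moduleM => //; exact: is_sos_sqr.
Qed.

End SumsOfSquares.

Section Putinar.
Context {R : realType}.

Lemma exprB1_bernoulli (y : R) n : 0 <= y <= 1 -> (1 - y) ^+ n * (1 + n%:R * y) <= 1.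
Proof.
move=> /andP[y0 y1]; elim: n => [|n IH]; first by rewrite expr0 mul0r addr0 mulr1.
apply: le_trans IH; rewrite exprSr -mulrA ler_wpM2l ?exprn_ge0 ?subr_ge0//.
by rewrite -natr1; have : 0 <= n%:R :> R by []; nra.
Qed.

(* The multiplier penalty c s k h makes penalty c s k h * h uniformly small where
   s h <= 1, and very negative where h is bounded away from 0 from below. *)
Definition penalty N (c s : R) k (h : {mpoly R[N]}) : {mpoly R[N]} :=
  c *: ((1 - s *: h) ^+ k) ^+ 2.

Lemma is_sos_penalty N c s k (h : {mpoly R[N]}) : 0 <= c -> is_sos (penalty c s k h).
Proof. by move=> c0; apply: is_sosZ => //; exact: is_sos_sqr. Qed.

Lemma meval_penaltyM N c s k (h : {mpoly R[N]}) x :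
  (penalty c s k h * h).@[x] = c * ((1 - s * h.@[x]) ^+ (k * 2) * h.@[x]).
Proof.
by rewrite mevalM mevalZ !rmorphXn /= mevalB meval1 mevalZ -exprM mulrA.
Qed.

Lemma penalty_le N c s k (h : {mpoly R[N]}) x : 0 <= c -> 0 < s -> (0 < k)%N ->
  s * h.@[x] <= 1 -> (penalty c s k h * h).@[x] <= c / (s * (k * 2)%:R).
Proof.
move=> c0 s0 k0; rewrite meval_penaltyM; move: (h.@[x]) => y sy1.
have K0 : 0 < (k * 2)%:R :> R by rewrite ltr0n muln_gt0 k0.
have P0 : 0 <= (1 - s * y) ^+ (k * 2) by rewrite exprM sqr_ge0.
rewrite ler_wpM2l//; have [y0|y0] := leP y 0.
  apply: (@le_trans _ _ 0); first by rewrite mulr_ge0_le0.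
  by rewrite invr_ge0 mulr_ge0// ltW.
have /(exprB1_bernoulli (k * 2)) : 0 <= s * y <= 1 by rewrite sy1 mulr_ge0 ?ltW.
rewrite -div1r ler_pdivlMr ?mulr_gt0//; move: (_ ^+ _) (_%:R) P0 K0 => P K P0 K0.
by nra.
Qed.

Lemma penalty_le_violated N c s k (h : {mpoly R[N]}) x : 0 <= c -> 0 <= s ->
  h.@[x] <= 0 -> (penalty c s k h * h).@[x] <= c * h.@[x].
Proof.
move=> c0 s0; rewrite meval_penaltyM; move: (h.@[x]) => y y0.
rewrite ler_wpM2l// ler_neMl// exprn_ege1// lerDl oppr_ge0.
by rewrite mulr_ge0_le0.
Qed.

Lemma pos_or_violated N (f : {mpoly R[N]}) (H : seq {mpoly R[N]}) (K : set (rvec R N)) :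
  compact K -> (forall x, K x -> nonneg_locus H x -> 0 < f.@[x]) ->
  exists2 eta, 0 < eta & forall x, K x ->
    eta <= f.@[x] \/ exists2 h, h \in H & h.@[x] <= - eta.
Proof.
move=> cK fH; pose G x : R := \big[Num.max/0]_(j < size H) (- (H`_j).@[x]).
pose F x : R := Num.max f.@[x] (G x).
have F0 x : K x -> 0 < F x.
  move=> Kx; rewrite /F lt_max; have [//|fx0] := ltP 0 f.@[x].
  have /existsNP[h /not_implyP[/(nthP 0)[j jH <-] /negP]] : ~ nonneg_locus H x.
    by move=> /(fH _ Kx); rewrite ltNge fx0.
  by rewrite -ltNge => hx; apply/bigmax_gtP; right; exists (Ordinal jH); rewrite ?oppr_gt0.
have cG : continuous G.
  apply: (continuous_big (@max_continuous _ R)) => j _ x.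
  exact: (cvgN (@meval_continuous R N H`_j x)).
have cF : continuous F by move=> x; exact: (continuous_max (@meval_continuous R N f x) (cG x)).
have [eta eta0 Feta] := compact_gt0_bound cK cF F0.
exists eta => // x /Feta; rewrite le_max => /orP[|/bigmax_geP[|[j _ Hj]]]; first by left.
  by rewrite leNgt eta0.
by right; exists H`_j; rewrite ?mem_nth// lerNr.
Qed.

Lemma meval_bounded N (H : seq {mpoly R[N]}) (K : set (rvec R N)) : compact K ->
  exists2 M, 0 < M & forall x h, K x -> h \in H -> `|h.@[x]| <= M.
Proof.
move=> cK; elim: H => [|h H [M M0 HM]]; first by exists 1.
have /ex_strict_bound_gt0[M' M'0 hM'] : bounded_set ((fun x => h.@[x]) @` K).
  apply: compact_bounded; apply: continuous_compact => //.
  exact: (continuous_subspaceT (@meval_continuous R N h)).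
exists (Num.max M M'); first by rewrite lt_max M0.
move=> x k Kx; rewrite inE => /predU1P[->|kH]; rewrite le_max; last by rewrite HM.
by rewrite [X in _ || X]ltW ?orbT//; apply: hM'; exists x.
Qed.

Lemma sum_penalty_le N (H : seq {mpoly R[N]}) c s k x : 0 <= c -> 0 < s -> (0 < k)%N ->
  (forall h, h \in H -> s * h.@[x] <= 1) ->
  (\sum_(h <- H) penalty c s k h * h).@[x] <= (size H)%:R * (c / (s * (k * 2)%:R)).
Proof.
move=> c0 s0 k0 sH; rewrite raddf_sum /= -sum1_size natr_sum mulr_suml !big_seq.
by apply: ler_sum => h hH; rewrite mul1r penalty_le ?sH.
Qed.

Lemma penalized_gt0 N (f : {mpoly R[N]}) (H : seq {mpoly R[N]}) M eta c k x :
  0 < M -> (forall h, h \in f :: H -> `|h.@[x]| <= M) ->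
  eta <= f.@[x] \/ (exists2 h, h \in H & h.@[x] <= - eta) ->
  0 <= c -> M + 1 <= c * eta -> 0 < eta -> (0 < k)%N ->
  (size H)%:R * (c / (M^-1 * (k * 2)%:R)) < Num.min eta 1 ->
  0 < (f - \sum_(h <- H) penalty c M^-1 k h * h).@[x].
Proof.
move=> M0 HM fH c0 Mc eta0 k0; rewrite lt_min => /andP[b_eta b_1].
have sH h : h \in H -> M^-1 * h.@[x] <= 1.
  move=> hH; rewrite mulrC ler_pdivrMr// mul1r (le_trans (ler_norm _))//.
  by rewrite HM// inE hH orbT.
have s0 : 0 < M^-1 by rewrite invr_gt0.
rewrite mevalB subr_gt0; case: fH => [f_eta|[h hH h_eta]].
  by apply: le_lt_trans (sum_penalty_le c0 s0 k0 sH) _; lra.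
have h_le0 : h.@[x] <= 0 by lra.
have pen_h := penalty_le_violated k c0 (ltW s0) h_le0.
have pen_rem : (\sum_(h' <- rem h H) penalty c M^-1 k h' * h').@[x] < 1.
  apply: le_lt_trans (sum_penalty_le c0 s0 k0 _) _.
    by move=> h' /mem_rem; exact: sH.
  apply: le_lt_trans b_1; rewrite ler_wpM2r ?ler_nat ?size_subseq ?rem_subseq//.
  by rewrite divr_ge0// mulr_ge0 ?(ltW s0).
have fM : - M <= f.@[x].
  by have := HM f (mem_head _ _); rewrite ler_norml => /andP[].
rewrite (big_rem h hH) mevalD /=; have : c * h.@[x] <= - (M + 1) by nra.
by lra.
Qed.

Lemma penalization N (f : {mpoly R[N]}) (H : seq {mpoly R[N]}) (K : set (rvec R N)) :
  compact K -> (forall x, K x -> nonneg_locus H x -> 0 < f.@[x]) ->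
  exists2 s : {mpoly R[N]} -> {mpoly R[N]}, (forall h, is_sos (s h)) &
    forall x, K x -> 0 < (f - \sum_(h <- H) s h * h).@[x].
Proof.
move=> cK fH; have [eta eta0 f_or_H] := pos_or_violated cK fH.
have [M M0 HM] := meval_bounded (f :: H) cK.
pose c := (M + 1) / eta; have c0 : 0 <= c by rewrite divr_ge0 ?addr_ge0 ?ltW.
pose d := Num.min eta 1; have d0 : 0 < d by rewrite lt_min eta0 ltr01.
near \oo => k; have k0 : (0 < k)%N by near: k; exact: nbhs_infty_gt.
have k_large : (size H)%:R * c * M / d <= k%:R by near: k; exact: nbhs_infty_ger.
exists (penalty c M^-1 k) => [h|x Kx]; first exact: is_sos_penalty.
apply: (penalized_gt0 M0 _ (f_or_H x Kx) c0 _ eta0 k0) => [h||].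
- exact: HM.
- by rewrite divfK ?gt_eqF.
rewrite invfM invrK !mulrA ltr_pdivrMr ?ltr0n ?muln_gt0 ?k0//.
have kd0 : 0 < k%:R * d by rewrite mulr_gt0// ltr0n.
by move: k_large; rewrite ler_pdivrMr// natrM -/d /c; lra.
Unshelve. all: by end_near. Qed.

Theorem putinar_sphere N (f : {mpoly R[N]}) (H : seq {mpoly R[N]}) :
  normsq_poly R N - 1 \in H -> 1 - normsq_poly R N \in H ->
  (forall x, nonneg_locus H x -> 0 < f.@[x]) -> exists k, Qmod k H f.
Proof.
move=> sphere_ge0 sphere_le0 fH; apply: quad_module_Qmod.
have [s sos_s /pos_cube_sos_mod_sphere[t [q [sos_t fE]]]] :=
  penalization (@compact_box R N (cst (-1)) (cst 1)) (fun x _ => fH x).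
rewrite -(subrK (\sum_(h <- H) s h * h) f) fE.
apply: quad_moduleD.
  by apply: quad_moduleD; [exact: quad_module_sos | exact: quad_module_sphere].
rewrite big_seq; apply: (big_ind (quad_module H)) => [||h hH].
- by apply: quad_module_sos; exact: is_sos0.
- exact: quad_moduleD.
- exact: quad_moduleM.
Qed.

End Putinar.

Section Homogenization.
Context {R : realType}.

Lemma meval_homogenize n (f : {mpoly R[n]}) (y : rvec R n.+1) :
  (homogenize f).@[y] = \sum_(m <- msupp f)
    f@_m * (y ord0 ^+ (mdegree f - mdeg m) * \prod_(i < n) y (lift ord0 i) ^+ m i).
Proof.
rewrite /homogenize raddf_sum; apply: eq_bigr => m _ /=.
rewrite mevalZ mevalM rmorphXn /= mevalXU rmorph_prod; congr (_ * (_ * _)).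
by apply: eq_bigr => i _ /=; rewrite rmorphXn /= mevalXU.
Qed.

Lemma meval_homogenizeZ n (f : {mpoly R[n]}) t (y : rvec R n.+1) :
  (homogenize f).@[t *: y] = t ^+ mdegree f * (homogenize f).@[y].
Proof.
rewrite !meval_homogenize mulr_sumr big_seq [RHS]big_seq; apply: eq_bigr => m mf.
have md : (mdeg m <= mdegree f)%N.
  by have := msize_mdeg_lt mf; rewrite /mdegree; case: (msize f).
under eq_bigr do rewrite [(t *: y) _]/(t * y _) exprMn.
rewrite big_split /= prodrXr -mdegE [(t *: y) _]/(t * y _) exprMn.
have -> : t ^+ mdegree f = t ^+ (mdegree f - mdeg m) * t ^+ mdeg m by rewrite -exprD subnK.
by rewrite [RHS]mulrCA; congr (_ * _); exact: mulrACA.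
Qed.

Lemma ext1_0 n (x : rvec R n) : ext1 x ord0 = 1.
Proof. by rewrite /ext1 unlift_none. Qed.

Lemma ext1_lift n (x : rvec R n) i : ext1 x (lift ord0 i) = x i.
Proof. by rewrite /ext1 liftK. Qed.

Lemma meval_homogenize_ext1 n (f : {mpoly R[n]}) (x : rvec R n) :
  (homogenize f).@[ext1 x] = f.@[x].
Proof.
rewrite meval_homogenize mevalE; apply: eq_bigr => m _.
rewrite ext1_0 expr1n mul1r; congr (_ * _); apply: eq_bigr => i _.
by rewrite ext1_lift.
Qed.

Lemma rvec_ext1E n (y : rvec R n.+1) : y ord0 != 0 ->
  y = y ord0 *: ext1 (fun j => y (lift ord0 j) / y ord0).
Proof.
move=> y0; apply/funext => i; rewrite fctE; case: (unliftP ord0 i) => [j|] ->.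
  by rewrite ext1_lift /GRing.scale /= mulrC divfK.
by rewrite ext1_0 /GRing.scale /= mulr1.
Qed.

Lemma dotp_ext1 n (v : rvec R n.+1) x :
  dotp v (ext1 x) = v ord0 + dotp (fun j => v (lift ord0 j)) x.
Proof.
rewrite /dotp big_ord_recl ext1_0 mulr1; congr (_ + _).
by apply: eq_bigr => i _; rewrite ext1_lift.
Qed.

Lemma meval_ext1_continuous n (p : {mpoly R[n.+1]}) :
  continuous (fun x : rvec R n => p.@[ext1 x]).
Proof.
have cext i : continuous (fun x : rvec R n => ext1 x i).
  rewrite /ext1; case: unlift => [j|]; last exact: cst_continuous.
  exact: (@rvec_coord_continuous R n j).
exact: (@continuous_meval R (rvec R n) _ p (@ext1 R n) cext).
Qed.

Definition linpoly N (v : rvec R N) : {mpoly R[N]} := \sum_(i < N) v i *: 'X_i.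

Lemma meval_linpoly N (v y : rvec R N) : (linpoly v).@[y] = dotp v y.
Proof.
by rewrite /linpoly raddf_sum; apply: eq_bigr => i _ /=; rewrite mevalZ mevalXU.
Qed.

Lemma linform_linpoly N (v : rvec R N) : linform (linpoly v).
Proof.
by apply: rpred_sum => i _; apply: rpredZ; rewrite dhomogX /= mdeg1.
Qed.

Lemma linformP N (l : {mpoly R[N]}) : linform l <-> exists v, l = linpoly v.
Proof.
split=> [ll|[v ->]]; last exact: linform_linpoly.
exists (fun i => l@_U_(i)); apply/mpolyP => m; rewrite /linpoly raddf_sum /=.
under eq_bigr do rewrite mcoeffZ mcoeffX.
have [/eqP/mdeg1P[i /eqP ->]|/eqP m1] := eqVneq (mdeg m) 1%N.
  rewrite (bigD1 i)//= eqxx mulr1 big1 ?addr0// => j ji.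
  by rewrite eq_mnm1 (negbTE ji) mulr0.
rewrite (dhomog_nemf_coeff ll) ?big1//; last exact/eqP.
move=> i _; case: eqP => [im|_]; last by rewrite mulr0.
by case: m1; rewrite -im mdeg1.
Qed.

Lemma meval_normsq N (y : rvec R N) : (normsq_poly R N).@[y] = vnorm y ^+ 2.
Proof.
rewrite sqr_sqrtr; last by apply: sumr_ge0 => i _; exact: sqr_ge0.
by rewrite raddf_sum; apply: eq_bigr => i _; rewrite /= rmorphXn /= mevalXU.
Qed.

Lemma nonneg_locus_Gtilde n m (g : 'I_m -> {mpoly R[n]}) :
  nonneg_locus (Gtilde g) = Stilde_c g `&` [set y | vnorm y = 1].
Proof.
have sphereE y : (vnorm y = 1) <-> (normsq_poly R n.+1).@[y] = 1.
  rewrite meval_normsq; split=> [->|/eqP]; first by rewrite expr1n.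
  by rewrite sqrp_eq1 ?sqrtr_ge0// => /eqP.
apply/seteqP; split=> y; last first.
  move=> [[gy y0] /sphereE yy] h; rewrite mem_cat => /orP[/mapP[j _ ->]//|].
  by rewrite !inE => /or3P[]/eqP ->; rewrite ?mevalXU// mevalB meval1 yy subrr.
move=> Gy; have Gy_last h :
    h \in [:: 'X_ord0; normsq_poly R n.+1 - 1; 1 - normsq_poly R n.+1] -> 0 <= h.@[y].
  by move=> hG; apply: (Gy); rewrite mem_cat hG orbT.
split; first split.
- move=> j; apply: Gy; rewrite mem_cat; apply/orP; left.
  by apply/mapP; exists j; rewrite ?mem_enum.
- by rewrite -(@mevalXU _ R y); apply: Gy_last; rewrite !inE eqxx.
apply/sphereE; have := Gy_last (normsq_poly R n.+1 - 1).
have := Gy_last (1 - normsq_poly R n.+1).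
by rewrite !inE !eqxx !orbT !mevalB meval1 => /(_ isT) ? /(_ isT) ?; lra.
Qed.

End Homogenization.

Section ThetaBody.
Context {R : realType} {n m : nat} (g : 'I_m -> {mpoly R[n]}).

Local Notation D := (closure (cvx_hull (Sset g))).

Lemma ext1_Stilde_c x : Sset g x -> Stilde_c g (ext1 x).
Proof. by move=> Sx; split=> [j|]; rewrite ?meval_homogenize_ext1// ext1_0 ler01. Qed.

Lemma Stilde_c_cone : is_cone (Stilde_c g).
Proof.
move=> t y t0 [gy y0]; split=> [j|]; last exact: mulr_ge0.
by rewrite meval_homogenizeZ mulr_ge0// exprn_ge0.
Qed.

Lemma closure_Stilde_o : closed_at_infinity g -> closure (Stilde_o g) = Stilde_c g.
Proof. by move=> gcl; apply/predeqP => y; rewrite -eclosureE; exact: gcl. Qed.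

Lemma linform_Qmod_ge0 k l y : Qmod k (Gtilde g) l -> linform l -> Stilde_c g y ->
  0 <= l.@[y].
Proof.
move=> Ql /linformP[v lE] Sy; have [->|/vnorm_gt0 y0] := pselect (y = 0).
  by rewrite lE meval_linpoly linear0.
have : 0 <= l.@[(vnorm y)^-1 *: y].
  apply: (Qmod_ge0 Ql); rewrite nonneg_locus_Gtilde; split.
    by apply: Stilde_c_cone => //; rewrite invr_ge0 ltW.
  by rewrite /= vnormZ gtr0_norm ?invr_gt0// mulVf// gt_eqF.
by rewrite lE !meval_linpoly linearZ /= pmulr_rge0// invr_gt0.
Qed.

Lemma subset_THtilde k l : (k <= l)%N -> THtilde g l `<=` THtilde g k.
Proof. by move=> kl x THx p Qp; apply: THx; exact: Qmod_leq kl Qp. Qed.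

Lemma closure_sub_THtilde k : D `<=` THtilde g k.
Proof.
move=> x Dx l Ql ll; have [v lE] := (linformP l).1 ll.
rewrite lE meval_linpoly dotp_ext1 -lerBlDl sub0r.
move: x Dx; apply: closure_halfspace; apply: cvx_hull_halfspace => x /ext1_Stilde_c Sx /=.
by rewrite -subr_ge0 opprK addrC -dotp_ext1 -meval_linpoly -lE (linform_Qmod_ge0 Ql ll).
Qed.

Lemma separating_form x : closed_at_infinity g -> D !=set0 -> ~ D x ->
  exists2 v, dual_cone (Stilde_c g) v & dotp v (ext1 x) < 0.
Proof.
move=> gcl D0 nDx.
have [w [c [wD wx]]] := separation (@closed_closure _ _)
  (closure_convex (@cvx_hull_convex _ _ _)) D0 nDx.
pose v : rvec R n.+1 := fun i => if unlift ord0 i is Some j then w j else - c.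
have v_ext1 z : dotp v (ext1 z) = dotp w z - c.
  rewrite dotp_ext1 /v unlift_none addrC; congr (dotp _ _ - c).
  by apply/funext => j; rewrite liftK.
exists v; last by rewrite v_ext1 subr_lt0.
rewrite -closure_Stilde_o//; apply: closure_halfspace => y [gy y0].
have yE := rvec_ext1E (lt0r_neq0 y0); rewrite /= yE linearZ /= v_ext1.
apply: mulr_ge0; first exact: ltW.
rewrite subr_ge0; apply: wD; apply: subset_closure; apply: sub_cvx_hull => j.
have := gy j; rewrite {1}yE meval_homogenizeZ meval_homogenize_ext1.
by rewrite pmulr_rge0// exprn_gt0.
Qed.

Lemma strictly_positive_form : AssumptionA g ->
  exists v, forall y, Stilde_c g y -> y <> 0 -> 0 < dotp v y.
Proof.
move=> [gcl []]; rewrite is_closedE eclosureE closure_Stilde_o// => clK ptK.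
have [v vK] := pointed_cone_dual_gt0 clK (@cvx_hull_convex _ _ _)
  (cvx_hull_cone Stilde_c_cone) ptK.
by exists v => y Sy; apply: vK; exact: sub_cvx_hull.
Qed.

Lemma cutting_form x : AssumptionA g -> D !=set0 -> ~ D x ->
  exists k l, [/\ Qmod k (Gtilde g) l, linform l & l.@[ext1 x] < 0].
Proof.
move=> gA D0 nDx; have [v vS vx] := separating_form gA.1 D0 nDx.
have [w wS] := strictly_positive_form gA.
have w1 : 0 < `|dotp w (ext1 x)| + 1 by rewrite ltr_wpDl.
pose d := - dotp v (ext1 x) / 2 / (`|dotp w (ext1 x)| + 1).
have d0 : 0 < d by rewrite !divr_gt0// oppr_gt0.
have l_pos y : nonneg_locus (Gtilde g) y -> 0 < (linpoly (v + d *: w)).@[y].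
  rewrite nonneg_locus_Gtilde => -[Sy y1]; rewrite meval_linpoly dotpDl dotpZl.
  apply: ltr_wpDl; first exact: vS.
  by apply: mulr_gt0 => //; apply: wS => //; exact: vnorm1_neq0.
have [||k Qk] := putinar_sphere _ _ l_pos; try by rewrite mem_cat !inE eqxx !orbT.
exists k, (linpoly (v + d *: w)); split=> //; first exact: linform_linpoly.
rewrite meval_linpoly dotpDl dotpZl.
have : d * dotp w (ext1 x) <= - dotp v (ext1 x) / 2.
  apply: (@le_trans _ _ (d * (`|dotp w (ext1 x)| + 1))); last by rewrite divfK ?gt_eqF.
  by rewrite ler_pM2l// (le_trans (ler_norm _))// lerDl.
by lra.
Qed.

Lemma near_not_THtilde x : AssumptionA g -> D !=set0 -> ~ D x ->
  exists k, \forall y \near x, ~ THtilde g k y.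
Proof.
move=> gA D0 /(cutting_form gA D0)[k [l [Ql ll lx]]]; exists k.
have ly : \forall y \near x, l.@[ext1 y] < 0.
  apply: open_nbhs_nbhs; split=> //=.
  exact: ((continuousP _).1 (@meval_ext1_continuous R n l) _ (@open_lt R 0)).
by apply: filterS ly => y ly /(_ l Ql ll); rewrite leNgt ly.
Qed.

Lemma THtilde_sub_add_eps_ball (B : set (rvec R n)) eps : AssumptionA g -> D !=set0 ->
  compact B -> 0 < eps ->
  \forall k \near \oo, THtilde g k `&` B `<=` add_eps_ball D eps.
Proof.
move=> gA D0 /compact_near_coveringP cB eps0.
suff : \forall k \near \oo, B `<=` (fun y => THtilde g k y -> add_eps_ball D eps y).
  by apply: filterS => k Bk y [Ty By]; exact: Bk.
apply: cB => x _; have [Dx|nDx] := pselect (D x).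
  exists (add_eps_ball D eps, setT) => [|[y k] []//]; split; last exact: filterT.
  exact: near_add_eps_ball.
have [k0 nT] := near_not_THtilde gA D0 nDx.
exists ([set y | ~ THtilde g k0 y], [set k | k0 <= k]%N) => [|[y k] [/= nTy k0k] Ty].
  by split; last exact: nbhs_infty_ge.
by case: nTy; exact: subset_THtilde Ty.
Qed.

End ThetaBody.

Unset Implicit Arguments.

Theorem mainTheorem9 (R : realType) (n m : nat) (g : 'I_m -> {mpoly R[n]}) :
  AssumptionA g ->
  forall eps r : R, 0 < eps -> 0 < r ->
  (exists x, eclosure (cvx_hull (Sset g)) x /\ eball r x) ->
  exists k : nat,
    set_sub (fun x => eclosure (cvx_hull (Sset g)) x /\ eball r x)
           (fun x => THtilde g k x /\ eball r x) /\
    set_sub (fun x => THtilde g k x /\ eball r x)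
           (fun x => add_eps_ball (eclosure (cvx_hull (Sset g))) eps x /\ eball r x).
Proof.
move=> gA eps r eps0 _ [x0 [Dx0 _]]; rewrite eclosureE in Dx0 *.
have [k TH_sub] := filter_ex (THtilde_sub_add_eps_ball gA (ex_intro _ x0 Dx0)
  (@compact_eball R n r) eps0).
exists k; split=> x [xA xr]; split=> //; first exact: closure_sub_THtilde.
exact: TH_sub.
Qed.
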